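(* Let $X\subset\Delta_{n-1}$ be a simplicial complex on $[n]$, let $a,b\subseteq[n]$ be non-empty disjoint subsets, and let $c\in\mathbb{Z}^n$ be the vector with $c^+=a$ and $c^-=b$. Let $\{N^1,\dots,N^\ell\}$ ($\ell\ge1$) be a non-empty set of subsets of $N_c$ corresponding to connected components of $\langle N_c\rangle$ that do not touch $\tilde N_c$, let $$M_X'=\langle\,\mathbf{x}^u: u\in\Delta_{n-1}\setminus X,\ (u\cup a)\setminus b\notin N^1\cup\dots\cup N^\ell\,\rangle+\langle\,\mathbf{x}^{v+c}: v\in\Delta_{n-1}\setminus X,\ (v\cup a)\setminus b\in N^1\cup\dots\cup N^\ell\,\rangle,$$ and let $F=\{f\setminus a: f\in N^1\cup\dots\cup N^\ell\}\subseteq 2^{[n]\setminus(a\cup b)}$. Then the following are equivalent: (i) the monomial ideal $M_X'$ is square-free; (ii) $(\mathbf{a}\ast F\ast\mathbf{b})\cap X=\mathbf{a}\ast F\ast\partial(\mathbf{b})$; (iii) $\mathbf{a}\ast F\ast\{b\}$ is disjoint from $X$; (iv) $X\cap(F\ast\{b\})=\emptyset$. If these conditions hold, then the neighboring simplicial complex $X'$ with $M_{X'}=M_X'$ is given by $$X'=\bigl(X\setminus(\mathbf{a}\ast F\ast\partial(\mathbf{b}))\bigr)\cup\bigl(\partial(\mathbf{a})\ast F\ast\mathbf{b}\bigr).$$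
   Context: $\mathbb{K}$ is a field, $[n]=\{1,\dots,n\}$, and $\Delta_{n-1}=2^{[n]}$ is the full simplex on $[n]$. Subsets of $[n]$ are identified with their incidence vectors in $\{0,1\}^n\subset\mathbb{Z}^n$. For a simplicial complex $X\subset\Delta_{n-1}$ the Stanley–Reisner ideal is $M_X=\langle\mathbf{x}^u: u\in\Delta_{n-1}\setminus X\rangle\subseteq\mathbb{K}[x_1,\dots,x_n]$. For $c=c^+-c^-\in\mathbb{Z}^n$ (positive and negative parts, both nonzero) with supports $a=\mathrm{supp}(c^+)$ and $b=\mathrm{supp}(c^-)$, set $$N_c=\{f\in X: a\subseteq f,\ f\cap b=\emptyset,\ f\cup b\notin X\},$$ $$\tilde N_c=\{f\in N_c: f\cup b'\notin X\text{ for some proper subset }b'\text{ of }b\}.$$ For a subset $N\subseteq X$, $\langle N\rangle$ denotes the union of all open simplices $|f|$, $f\in N$, in the geometric realization $|X|$. A connected component of $\langle N_c\rangle$ corresponds to the subset of those $f\in N_c$ whose open simplex lies in it; it does not touch $\tilde N_c$ if this subset contains no element of $\tilde N_c$. Further notation: $\mathbf{a}=\{f: f\subseteq a\}$ is the full simplex on $a$, $\partial(\mathbf{a})=\{f: f\subsetneq a\}$, and $\mathbf{b},\partial(\mathbf{b})$ are defined similarly from $b$. For collections $Y,Z$ of sets on disjoint sets of vertices, $Y\ast Z=\{f\cup g: f\in Y,\ g\in Z\}$. Here $\{b\}$ denotes the collection whose only member is the set $b$. *)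

(* Defs.v *)
From HB Require Import structures.
From mathcomp Require Import all_boot all_order all_algebra.
From mathcomp Require Import all_classical all_reals all_analysis.
From mathcomp Require mpoly.
(* The notations of mpoly clash with those of mathcomp-analysis. *)
Import -(notations) mpoly.

Set Implicit Arguments.
Unset Strict Implicit.
Unset Printing Implicit Defensive.

Import Order.TTheory GRing.Theory Num.Theory.
Import numFieldNormedType.Exports.

Local Open Scope ring_scope.

(* A collection of faces on the vertex set [n] is a {set {set 'I_n}}. As in the
   identification Delta_(n-1) = 2^[n], the empty collection counts as a
   simplicial complex and not every vertex of [n] has to be a face. *)
Definition simplicial_complex (n : nat) (X : {set {set 'I_n}}) : Prop :=
  forall f g : {set 'I_n}, f \in X -> g \subset f -> g \in X.

Definition join (n : nat) (Y Z : {set {set 'I_n}}) : {set {set 'I_n}} :=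
  [set f :|: g | f in Y, g in Z].

Definition full_simplex (n : nat) (a : {set 'I_n}) : {set {set 'I_n}} :=
  [set f : {set 'I_n} | f \subset a].

Definition bd_simplex (n : nat) (a : {set 'I_n}) : {set {set 'I_n}} :=
  [set f : {set 'I_n} | f \proper a].

Definition incidence (n : nat) (u : {set 'I_n}) : 'rV[int]_n :=
  \row_i (i \in u)%:Z.

Definition pos_part (n : nat) (c : 'rV[int]_n) : 'rV[int]_n :=
  \row_i Num.max (c 0 i) 0.

Definition neg_part (n : nat) (c : 'rV[int]_n) : 'rV[int]_n :=
  \row_i Num.max (- c 0 i) 0.

Definition supp (n : nat) (c : 'rV[int]_n) : {set 'I_n} :=
  [set i | c 0 i != 0].

Definition Nset (n : nat) (X : {set {set 'I_n}}) (c : 'rV[int]_n) :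
    {set {set 'I_n}} :=
  [set f in X | [&& supp (pos_part c) \subset f,
                    f :&: supp (neg_part c) == finset.set0 &
                    f :|: supp (neg_part c) \notin X]].

Definition Ntilde (n : nat) (X : {set {set 'I_n}}) (c : 'rV[int]_n) :
    {set {set 'I_n}} :=
  [set f in Nset X c |
    [exists b' : {set 'I_n},
      (b' \proper supp (neg_part c)) && (f :|: b' \notin X)]].

(* The open simplex |f|, in barycentric coordinates inside R^n; it is empty
   for the empty face. *)
Definition open_simplex (R : realType) (n : nat) (f : {set 'I_n}) :
    set 'rV[R]_n :=
  [set x : 'rV[R]_n | [/\ forall i, 0 <= x 0 i,
                          \sum_i x 0 i = 1 &
                          forall i, (x 0 i != 0) = (i \in f)]]%classic.

Arguments open_simplex R {n} f.

(* For N = X this is the geometric realization |X|, and for a subset N of X it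
   is the subspace <N> of |X|. *)
Definition realization (R : realType) (n : nat) (N : {set {set 'I_n}}) :
    set 'rV[R]_n :=
  (\bigcup_(f in [set` N]) open_simplex R f)%classic.

Arguments realization R {n} N.

Definition is_component (T : topologicalType) (A C : set T) : Prop :=
  exists2 x : T, A x & C = connected_component A x.

(* N' is the subset of N that corresponds to a connected component of <N>. *)
Definition component_faces (R : realType) (n : nat)
    (N N' : {set {set 'I_n}}) : Prop :=
  exists2 C : set 'rV[R]_n, is_component (realization R N) C &
    forall f : {set 'I_n},
      f \in N' <-> f \in N /\ (open_simplex R f `<=` C)%classic.

Arguments component_faces R {n} N N'.

Definition is_ideal (A : comNzRingType) (I : set A) : Prop :=
  [/\ I 0, forall p q, I p -> I q -> I (p + q) &
      forall r p, I p -> I (r * p)].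

Definition ideal_generated (A : comNzRingType) (G : set A) : set A :=
  smallest (@is_ideal A) G.

Definition ideal_sum (A : comNzRingType) (I J : set A) : set A :=
  [set p + q | p in I & q in J]%classic.

(* The ideal < x^e : e in E > of K[x_1, ..., x_n]. The generators are indexed by
   vectors of Z^n; only e in N^n has a monomial x^e. *)
Definition monomial_ideal (K : fieldType) (n : nat) (E : set 'rV[int]_n) :
    set (mpoly n K) :=
  ideal_generated
    [set p | exists2 m : multinom n,
       E (\row_i (m i)%:Z) & p = mpolyX K m]%classic.

Arguments monomial_ideal K {n} E.

Definition squarefree_ideal (K : fieldType) (n : nat)
    (I : set (mpoly n K)) : Prop :=
  exists2 E : set 'rV[int]_n,
    (forall e, E e -> forall i, 0 <= e 0 i <= 1) & I = monomial_ideal K E.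

Definition SR_ideal (K : fieldType) (n : nat) (X : {set {set 'I_n}}) :
    set (mpoly n K) :=
  monomial_ideal K
    [set e | exists2 u : {set 'I_n}, u \notin X & e = incidence u]%classic.

Arguments SR_ideal K {n} X.

(* The ideal M_X' of the union N of the chosen component subsets; intended for
   c = incidence a - incidence b. *)
Definition modified_ideal (K : fieldType) (n : nat) (X : {set {set 'I_n}})
    (a b : {set 'I_n}) (c : 'rV[int]_n) (N : {set {set 'I_n}}) :
    set (mpoly n K) :=
  ideal_sum
    (monomial_ideal K
      [set e | exists u : {set 'I_n},
         [/\ u \notin X, (u :|: a) :\: b \notin N & e = incidence u]]%classic)
    (monomial_ideal K
      [set e | exists v : {set 'I_n},
         [/\ v \notin X, (v :|: a) :\: b \in N & e = incidence v + c]]%classic).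

Arguments modified_ideal K {n} X a b c N.

Lemma supp_pos_part (n : nat) (a : {set 'I_n}) (c : 'rV[int]_n) :
  pos_part c = incidence a -> supp (pos_part c) = a.
Proof.
by move=> ->; apply/setP => i; rewrite inE mxE; case: (i \in a).
Qed.

Lemma supp_neg_part (n : nat) (b : {set 'I_n}) (c : 'rV[int]_n) :
  neg_part c = incidence b -> supp (neg_part c) = b.
Proof.
by move=> ->; apply/setP => i; rewrite inE mxE; case: (i \in b).
Qed.

(* All exponents v + c in modified_ideal are non-negative as soon as N avoids
   Ntilde, so monomial_ideal drops none of its generators. *)
Lemma modified_exponent_ge0 (n : nat) (X : {set {set 'I_n}})
    (a b v : {set 'I_n}) (c : 'rV[int]_n) (N : {set {set 'I_n}}) :
  simplicial_complex X ->
  pos_part c = incidence a -> neg_part c = incidence b ->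
  N \subset Nset X c -> [disjoint N & Ntilde X c] ->
  v \notin X -> (v :|: a) :\: b \in N ->
  forall i, 0 <= (incidence v + c) 0 i.
Proof.
move=> cplX posc negc sNN dN vX fN i.
have sbv : b \subset v.
  apply/negPn/negP => nsbv.
  have := disjointFr dN fN; rewrite inE (fintype.subsetP sNN _ fN) /=.
  rewrite (supp_neg_part negc) => /existsP; case; exists (v :&: b).
  rewrite properE finset.subsetIr finset.subsetI negb_and nsbv /=.
  apply: contra vX => /cplX; apply; apply/fintype.subsetP => j jv.
  by rewrite !inE jv /=; case: (j \in b).
have /rowP/(_ i) := negc; rewrite !mxE => ci.
have : Num.max (- c 0 i) 0 <= (i \in v)%:Z.
  by rewrite ci; have := fintype.subsetP sbv i; case: (i \in b) => [->|].
by rewrite ge_max -[X in 0 <= _ + X]opprK subr_ge0 => /andP[].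
Qed.

(* Main.v *)
Require Import Defs.
From mathcomp Require Import all_boot all_order all_algebra.
From mathcomp Require Import all_classical all_reals all_analysis.
From mathcomp Require mpoly.
Import -(notations) mpoly.

Set Implicit Arguments.
Unset Strict Implicit.
Unset Printing Implicit Defensive.

(** The faces f of the chosen components are treated through their union U,
and everything follows from three properties of U. Each f in U lies in X,
contains a, misses b and has f :|: b outside X; f :|: b' lies in X for every
proper subset b' of b, since the components do not touch Ntilde; and U is
closed under comparability inside N_c ([component_faces_comparable]): when
f is a subset of g, the segment from a point of |f| to a point of |g| stays in
the union of |f| and |g|, so both open simplices lie in one component.

The core (u :|: a) :\: b of a set u decides which kind of generator u gives.
A non-face v whose core f lies in U contains b, and x^(v + c) is x^f times the
part of x^v over a; it is square-free exactly when v = (f :\: a) :|: b. So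
(iv), which says that these sets are non-faces, makes M' generated by the
square-free monomials x^u (u not in X, core outside U) and x^f (f in U). By
closure of U under comparability, the sets that contain the support of one of
these monomials are the non-faces of X' ([flip_nonface]); hence X' is a complex, M' is its Stanley-Reisner ideal,
and (i) holds.

Conversely, suppose that M' is square-free and f is in U. Then v = f :|: b
yields the generator x^f x^a, so x^f lies in M' because M' is radical. As f is
a face, x^f is divisible by a generator x^(v + c) of the second kind, and this
forces v to be a subset of (f :\: a) :|: b; the latter is therefore a non-face,
which is (iv) ([squarefree_missing]). The equivalence of (ii), (iii) and (iv)
is bookkeeping, since membership in the three-fold joins depends only on the
core of a set and on its traces on a and b ([mem_join3]).

Ideals are compared through monomials: p lies in a monomial ideal iff every
monomial of p is a multiple of a generator ([mem_monomial_ideal]). *)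

(** * Monomial ideals *)

Section MonomialIdeals.
Import Order.TTheory GRing.Theory Num.Theory.
Local Open Scope ring_scope.
Context (K : fieldType) (n : nat).
Implicit Types (E : set 'rV[int]_n) (m : multinom n) (p q : mpoly n K).

(** Only exponents e in N^n have a monomial, hence the lower bound: a vector of E
with a negative entry generates nothing. *)
Definition multiple E m :=
  exists2 e : 'rV[int]_n, E e & forall i, 0 <= e 0 i <= (m i)%:Z.

Lemma ideal_generated_ideal (A : comNzRingType) (G : set A) :
  is_ideal (ideal_generated G).
Proof.
split=> [I [[I0 _ _] _]|p q pG qG I HI|r p pG I HI] //.
  by case: (HI) => -[_ ID _] _; apply: ID; [exact: pG|exact: qG].
by case: (HI) => -[_ _ IM] _; apply: IM; exact: pG.
Qed.

(** The polynomials whose monomials are all multiples of generators form an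
ideal, because the monomials of a product are products of monomials. *)
Lemma mem_monomial_ideal E p :
  monomial_ideal K E p <-> (forall m, m \in msupp p -> multiple E m).
Proof.
split=> [pE|pE].
  pose S : set (mpoly n K) := fun p => forall m, m \in msupp p -> multiple E m.
  suff : S p by [].
  apply: (smallest_sub _ _ pE) => [|_ [m mE ->] m']; last first.
    rewrite msuppX inE => /eqP ->; exists (\row_i (m i)%:Z) => // i.
    by rewrite mxE lexx.
  split=> [m|q r Sq Sr m|r q Sq m].
  - by rewrite msupp0.
  - by move=> /msuppD_le; rewrite mem_cat => /orP[/Sq|/Sr].
  - move=> /msuppM_le /allpairsP[[m1 m2] /= [_ /Sq[e eE em] ->]].
    exists e => // i; have /andP[-> /le_trans ->] := em i => //.
    by rewrite mnmDE lez_nat leq_addl.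
have [I0 ID IM] : is_ideal (monomial_ideal K E) by exact: ideal_generated_ideal.
rewrite (mpolyE p) big_seq; apply: (big_ind (monomial_ideal K E)) => // m /pE.
case=> e eE em; rewrite -mul_mpolyC; apply: (IM).
pose m0 := Multinom [tuple absz (e 0%R i) | i < n].
have m0E i : (m0 i)%:Z = e 0 i.
  by rewrite mnmE gez0_abs //; case/andP: (em i).
have m0m : lem m0 m.
  by apply/mnm_lepP => i; rewrite -lez_nat m0E; case/andP: (em i).
rewrite -(submK m0m) mpolyXD; apply: IM; apply: sub_gen_smallest.
exists m0 => //; rewrite (_ : (\row_i _) = e) //.
by apply/rowP => i; rewrite mxE m0E.
Qed.

Lemma monomial_ideal_X E m : monomial_ideal K E (mpolyX K m) <-> multiple E m.
Proof.
rewrite mem_monomial_ideal msuppX; split=> [|mE m']; first by apply; rewrite inE.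
by rewrite inE => /eqP ->.
Qed.

Lemma eq_monomial_ideal E1 E2 : (forall m, multiple E1 m <-> multiple E2 m) ->
  monomial_ideal K E1 = monomial_ideal K E2.
Proof.
move=> E12; apply/seteqP; split=> p /mem_monomial_ideal pE;
  apply/mem_monomial_ideal => m /pE; by rewrite E12.
Qed.

Lemma multipleU E1 E2 m :
  multiple (E1 `|` E2)%classic m <-> multiple E1 m \/ multiple E2 m.
Proof.
split=> [[e [] eE em]|[[e eE em]|[e eE em]]].
- by left; exists e.
- by right; exists e.
- by exists e => //; left.
- by exists e => //; right.
Qed.

Lemma ideal_sum_monomial E1 E2 :
  ideal_sum (monomial_ideal K E1) (monomial_ideal K E2) =
  monomial_ideal K (E1 `|` E2)%classic.
Proof.
have [I0 ID IM] : is_ideal (monomial_ideal K (E1 `|` E2)%classic).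
  exact: ideal_generated_ideal.
have [I0_1 ID1 IM1] : is_ideal (monomial_ideal K E1).
  exact: ideal_generated_ideal.
have [I0_2 ID2 IM2] : is_ideal (monomial_ideal K E2).
  exact: ideal_generated_ideal.
apply/seteqP; split=> [_ [p /mem_monomial_ideal pE] [q /mem_monomial_ideal qE] <-|].
  apply: ID; apply/mem_monomial_ideal => m mp; apply/multipleU.
  - by left; exact: pE.
  - by right; exact: qE.
apply: smallest_sub => [|_ [m mE ->]].
  split=> [|_ _ [p1 pE1 [p2 pE2 <-]] [q1 qE1 [q2 qE2 <-]]|r _ [p1 pE1 [p2 pE2 <-]]].
  - by exists 0 => //; exists 0 => //; rewrite addr0.
  - exists (p1 + q1); first exact: ID1.
    by exists (p2 + q2); [exact: ID2|rewrite addrACA].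
  - exists (r * p1); first exact: IM1.
    by exists (r * p2); [exact: IM2|rewrite mulrDr].
case: mE => mE.
  exists (mpolyX K m); last by exists 0; rewrite ?addr0.
  by apply: sub_gen_smallest; exists m.
exists 0 => //; exists (mpolyX K m); last by rewrite add0r.
by apply: sub_gen_smallest; exists m.
Qed.

Definition mnm_support m : {set 'I_n} := [set i | m i != 0%N]%SET.
Definition mnm_of_set (u : {set 'I_n}) : multinom n :=
  Multinom [tuple nat_of_bool (i \in u) | i < n].

Lemma mnm_of_setK u : mnm_support (mnm_of_set u) = u.
Proof. by apply/setP => i; rewrite inE mnmE; case: (i \in u). Qed.

Lemma incidence_le (u : {set 'I_n}) m :
  (forall i, 0 <= incidence u 0 i <= (m i)%:Z) <-> u \subset mnm_support m.
Proof.
split=> [um|/fintype.subsetP um i].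
  apply/fintype.subsetP => i iu; move: (um i); rewrite mxE iu inE.
  by case: (m i).
by rewrite mxE; move: (um i); rewrite inE; case: (i \in u) => // /(_ isT); case: (m i).
Qed.

Lemma multiple_SR (Y : {set {set 'I_n}}) m : simplicial_complex Y ->
  multiple [set e | exists2 u : {set 'I_n}, u \notin Y & e = incidence u]%classic m
  <-> mnm_support m \notin Y.
Proof.
move=> cplY; split=> [[_ [u uY ->] /incidence_le um]|mY].
  by apply: contra uY => /cplY; apply.
by exists (incidence (mnm_support m)); [exists (mnm_support m)|apply/incidence_le].
Qed.

Lemma SR_ideal_X (Y : {set {set 'I_n}}) m : simplicial_complex Y ->
  SR_ideal K Y (mpolyX K m) <-> mnm_support m \notin Y.
Proof. by move=> cplY; rewrite -multiple_SR // -monomial_ideal_X. Qed.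

(** The square-free monomials of the ideal are exactly the non-faces. *)
Lemma SR_ideal_inj (Y Z : {set {set 'I_n}}) :
  simplicial_complex Y -> simplicial_complex Z ->
  SR_ideal K Y = SR_ideal K Z -> Y = Z.
Proof.
move=> cY cZ YZ; apply/setP => u; apply/negb_inj.
suff : u \notin Y <-> u \notin Z by case=> YZu ZYu; apply/idP/idP.
by rewrite -(mnm_of_setK u) -!SR_ideal_X // YZ.
Qed.

Lemma SR_ideal_squarefree (Y : {set {set 'I_n}}) : squarefree_ideal (SR_ideal K Y).
Proof.
exists [set e | exists2 u : {set 'I_n}, u \notin Y & e = incidence u]%classic => //.
by move=> _ [u _ ->] i; rewrite mxE; case: (i \in u).
Qed.

(** A square-free generator dividing x^m only involves the variables of x^m, each
at most once, so it divides every monomial with at least these variables. *)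
Lemma squarefree_radical (I : set (mpoly n K)) m m' :
  squarefree_ideal I -> I (mpolyX K m) -> mnm_support m \subset mnm_support m' ->
  I (mpolyX K m').
Proof.
move=> [E E01 ->] /monomial_ideal_X [e eE em] /fintype.subsetP mm'.
apply/monomial_ideal_X; exists e => // i.
have /andP[e0 e1] := E01 e eE i; rewrite e0 /=.
case m'i: (m' i) => [|k]; last by apply: le_trans e1 _.
have : i \notin mnm_support m by apply/negP => /mm'; rewrite inE m'i.
by rewrite inE negbK; case/andP: (em i) => _ /[swap] /eqP ->.
Qed.

Lemma incidence_diff (a b : {set 'I_n}) (c : 'rV[int]_n) :
  pos_part c = incidence a -> neg_part c = incidence b ->
  c = incidence a - incidence b.
Proof.
move=> <- <-; apply/rowP => i; rewrite !mxE.
rewrite oppr_max oppr0 opprK addrC.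
by case: (lerP (c 0 i) 0) => c0; rewrite ?addr0 ?add0r.
Qed.

End MonomialIdeals.

(** * Components of the realization *)

Section Realization.
Import Order.TTheory GRing.Theory Num.Theory numFieldNormedType.Exports.
Local Open Scope ring_scope.
Local Open Scope classical_set_scope.
Context (R : realType) (n : nat).
Implicit Types (f g : {set 'I_n}) (N : {set {set 'I_n}}) (x y : 'rV[R]_n).

Definition segment x y : set 'rV[R]_n :=
  [set x + t *: (y - x) | t in `[0, 1]].

Lemma segment_connected x y : connected (segment x y).
Proof.
apply: connected_continuous_connected; first exact: segment_connected.
apply: continuous_subspaceT => t.
apply: cvgD; first exact: cvg_cst.
by apply: cvgZr_tmp; exact: cvg_id.
Qed.

Lemma segment_left x y : segment x y x.
Proof. by exists 0; rewrite ?scale0r ?addr0 //= in_itv /= lexx ler01. Qed.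

Lemma segment_right x y : segment x y y.
Proof. by exists 1; rewrite ?scale1r ?subrKC //= in_itv /= lexx ler01. Qed.

(** Away from x, a point of the segment is a combination of x and y with positive
weight on y, so its support is the union of the two supports, that is g. *)
Lemma open_simplex_segment f g x y : f \subset g ->
  open_simplex R f x -> open_simplex R g y ->
  segment x y `<=` open_simplex R f `|` open_simplex R g.
Proof.
move=> /fintype.subsetP fg [x0 x1 xf] [y0 y1 yg] _ [t /= /[!in_itv] /= /andP[t0 t1] <-].
have zE i : (x + t *: (y - x)) 0 i = (1 - t) * x 0 i + t * y 0 i.
  by rewrite !mxE mulrBr mulrBl mul1r addrA addrAC.
have z0 i : 0 <= (x + t *: (y - x)) 0 i.
  by rewrite zE addr_ge0 // mulr_ge0 // subr_ge0.
have z1 : \sum_i (x + t *: (y - x)) 0 i = 1.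
  rewrite (eq_bigr _ (fun i _ => zE i)) big_split /= -!mulr_sumr x1 y1.
  by rewrite !mulr1 subrK.
have [->|tn0] := eqVneq t 0; first by left; rewrite scale0r addr0.
right; split=> // i.
have tgt0 : 0 < t by rewrite lt_neqAle eq_sym tn0.
rewrite -yg zE paddr_eq0 ?mulr_ge0 ?subr_ge0 // negb_and !mulf_eq0 (negbTE tn0) /=.
rewrite !negb_or xf yg.
by case fi: (i \in f); rewrite ?(fg _ fi) ?orbT ?andbF.
Qed.

Lemma open_simplex_neq0 f : f != finset.set0 -> open_simplex R f !=set0.
Proof.
move=> f0; have k0 : #|f|%:R != 0 :> R by rewrite pnatr_eq0 cards_eq0.
exists (\row_i (if i \in f then #|f|%:R^-1 else 0)); split=> [i||i].
- by rewrite mxE; case: ifP; rewrite ?invr_ge0.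
- rewrite (eq_bigr (fun i => if i \in f then #|f|%:R^-1 else 0)); last first.
    by move=> i _; rewrite mxE.
  rewrite -big_mkcond /= sumr_const -[LHS]mulr_natr mulVf //.
- by rewrite mxE; case: ifP; rewrite ?invr_neq0 ?eqxx.
Qed.

(** The face f must be non-empty, as the open simplex of the empty face is empty
and would be contained in every component. *)
Lemma component_faces_comparable N N' f g :
  component_faces R N N' -> f \in N' -> f != finset.set0 -> g \in N ->
  (f \subset g) || (g \subset f) -> g \in N'.
Proof.
move=> [C [x0 _ ->] NE] /NE[fN fC] f0 gN fg; apply/NE; split=> // y gy.
have [x fx] := open_simplex_neq0 f0.
apply: connected_component_trans (fC _ fx) _.
have sub h : h \in N -> open_simplex R h `<=` realization R N.
  by move=> hN z hz; exists h.
case/orP: fg => fg.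
  exists (segment x y); last exact: segment_right.
  split; [exact: segment_left| |exact: segment_connected].
  by apply: (subset_trans (open_simplex_segment fg fx gy)) => z [];
    exact: sub.
apply: connected_component_sym; exists (segment y x); last exact: segment_right.
split; [exact: segment_left| |exact: segment_connected].
by apply: (subset_trans (open_simplex_segment fg gy fx)) => z [];
  exact: sub.
Qed.

End Realization.

(** * The faces over a and the combinatorial flip *)

(** Identities between sets are checked vertex by vertex: inclusions and
disjointness are specialized to a vertex, and the membership bits are
enumerated. *)
Lemma subset_at (T : finType) (A B : {set T}) :
  A \subset B -> forall x, (x \in A) ==> (x \in B).
Proof. by move=> /fintype.subsetP AB x; apply/implyP/AB. Qed.

Lemma disjoint_at (T : finType) (A B : {set T}) :
  [disjoint A & B] -> forall x, ~~ ((x \in A) && (x \in B)).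
Proof.
move=> /finset.setDidPl AB x; apply/negP => /andP[xA xB].
by move: xA; rewrite -AB inE xB.
Qed.

Ltac set_cases :=
  rewrite ?inE; repeat match goal with
  | |- context [in_mem ?i ?A] => case: (in_mem i A) => //=
  end.

Section Flip.

Context (n : nat) (X : {set {set 'I_n}}) (a b : {set 'I_n}).
Context (U : {set {set 'I_n}}).
Implicit Types f g p u v w : {set 'I_n}.

(** The set in N_c, if any, that agrees with u outside of a and b. *)
Definition core u : {set 'I_n} := (u :|: a) :\: b.
Definition linkF : {set {set 'I_n}} := [set f :\: a | f in U]%SET.

Hypothesis cplX : simplicial_complex X.
Hypothesis dab : [disjoint a & b].
Hypothesis U_N : forall f, f \in U ->
  [/\ f \in X, a \subset f, [disjoint f & b] & f :|: b \notin X].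
Hypothesis U_bd : forall f (b' : {set 'I_n}), f \in U -> b' \proper b -> f :|: b' \in X.
Hypothesis U_comparable : forall f g, f \in U -> g \in X -> a \subset g ->
  [disjoint g & b] -> g :|: b \notin X -> (f \subset g) || (g \subset f) ->
  g \in U.

Lemma nonfaceS f g : f \notin X -> f \subset g -> g \notin X.
Proof. by move=> fX fg; apply: contra fX => /cplX; exact. Qed.

Lemma core_sub u : a \subset u -> core u \subset u.
Proof. by move=> /subset_at au; apply/fintype.subsetP => i; move: (au i); set_cases. Qed.

Lemma sub_core u : a \subset core u.
Proof. by apply/fintype.subsetP => i; move: (disjoint_at dab i); set_cases. Qed.

Lemma core_disjoint u : [disjoint core u & b].
Proof. by apply/finset.setDidPl/setP => i; set_cases. Qed.

Lemma coreS u v : u \subset v -> core u \subset core v.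
Proof. by move=> /subset_at uv; apply/fintype.subsetP => i; move: (uv i); set_cases. Qed.

Lemma core_id f : f \in U -> core f = f.
Proof.
case/U_N => _ /subset_at af /disjoint_at fb _.
by apply/setP => i; move: (af i) (fb i); set_cases.
Qed.

Lemma sub_core_id f u : f \in U -> f \subset u -> f \subset core u.
Proof. by move=> fU fu; rewrite -(core_id fU) coreS. Qed.

Lemma core_F_b f : f \in U -> core ((f :\: a) :|: b) = f.
Proof.
case/U_N => _ /subset_at af /disjoint_at fb _.
by apply/setP => i; move: (af i) (fb i); set_cases.
Qed.

(** The vertex sets a, b and their complement are disjoint, so the three
components of a member of the join are recovered from its traces. *)
Lemma mem_join3 (A B : {set {set 'I_n}}) u :
  A \subset full_simplex a -> B \subset full_simplex b ->
  (u \in join (join A linkF) B) =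
    [&& u :&: a \in A, core u \in U & u :&: b \in B].
Proof.
move=> /fintype.subsetP Aa /fintype.subsetP Bb; apply/imset2P/and3P.
  move=> [q y /imset2P[x p xA /imsetP[f fU ->] ->] yB ->].
  have /[!inE] /subset_at xa := Aa _ xA.
  have /[!inE] /subset_at yb := Bb _ yB.
  case/U_N: (fU) => _ /subset_at af /disjoint_at fb _.
  move/disjoint_at: dab => ab; split.
  - rewrite (_ : _ :&: a = x) //; apply/setP => i.
    by move: (xa i) (yb i) (ab i); set_cases.
  - rewrite (_ : core _ = f) //; apply/setP => i.
    by move: (xa i) (yb i) (ab i) (fb i) (af i); set_cases.
  - rewrite (_ : _ :&: b = y) //; apply/setP => i.
    by move: (xa i) (yb i) (ab i) (fb i); set_cases.
move=> [uA uU uB]; exists ((u :&: a) :|: (core u :\: a)) (u :&: b) => //.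
  by apply: imset2_f => //; apply: imset_f.
by apply/setP => i; set_cases.
Qed.

(** Otherwise v would be a subset of core v :|: (v :&: b), which is a face since
core v is not in Ntilde. *)
Lemma nonface_sub_b v : v \notin X -> core v \in U -> b \subset v.
Proof.
move=> vX vU; apply: contraNT vX => bv.
suff : core v :|: (v :&: b) \in X.
  by move/cplX; apply; apply/fintype.subsetP => i; set_cases.
apply: U_bd => //; rewrite properE finset.subsetIr /=.
by apply: contra bv; rewrite finset.subsetI => /andP[].
Qed.

Lemma core_face u : core u \in U -> ~~ (b \subset u) -> u \in X.
Proof. by move=> uU; apply: contraNT => uX; exact: nonface_sub_b. Qed.

(** Condition (iv), one face at a time. *)
Definition F_b_missing := forall f, f \in U -> (f :\: a) :|: b \notin X.

Lemma F_b_missingP : F_b_missing <-> X :&: join linkF [set b]%SET = finset.set0.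
Proof.
split=> [miss|X0 f fU].
  apply/setP => u; rewrite !inE; apply/negP => /andP[uX].
  case/imset2P => p q /imsetP[f fU ->]; rewrite inE => /eqP -> uE.
  by move: (miss f fU); rewrite -uE uX.
apply/negP => fX; suff : (f :\: a) :|: b \in X :&: join linkF [set b]%SET.
  by rewrite X0 inE.
rewrite inE fX; apply/imset2P; exists (f :\: a) b; rewrite ?inE //.
exact: imset_f.
Qed.

Let aF := join (full_simplex a) linkF.

Lemma bd_full (c : {set 'I_n}) : bd_simplex c \subset full_simplex c.
Proof. by apply/fintype.subsetP => f; rewrite !inE => /proper_sub. Qed.

Lemma top_full (c : {set 'I_n}) : [set c]%SET \subset full_simplex c.
Proof. by apply/fintype.subsetP => f; rewrite !inE => /eqP ->. Qed.

Lemma proper_setIr u (c : {set 'I_n}) : (u :&: c \proper c) = ~~ (c \subset u).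
Proof. by rewrite properE finset.subsetIr finset.subsetI subxx andbT. Qed.

Lemma mem_full_full u : (u \in join aF (full_simplex b)) = (core u \in U).
Proof. by rewrite mem_join3 ?subxx // !inE !finset.subsetIr andbT. Qed.

Lemma mem_full_bd u :
  (u \in join aF (bd_simplex b)) = (core u \in U) && ~~ (b \subset u).
Proof.
by rewrite mem_join3 ?subxx ?bd_full // !inE finset.subsetIr proper_setIr.
Qed.

Lemma mem_full_top u :
  (u \in join aF [set b]%SET) = (core u \in U) && (b \subset u).
Proof.
rewrite mem_join3 ?subxx ?top_full // !inE finset.subsetIr /=.
by rewrite (sameP eqP finset.setIidPr).
Qed.

Lemma mem_bd_full u :
  (u \in join (join (bd_simplex a) linkF) (full_simplex b)) =
  (core u \in U) && ~~ (a \subset u).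
Proof.
rewrite mem_join3 ?subxx ?bd_full // !inE finset.subsetIr proper_setIr.
by rewrite andbT andbC.
Qed.

Lemma F_b_sub u : b \subset u -> (core u :\: a) :|: b \subset u.
Proof.
by move=> /subset_at bu; apply/fintype.subsetP => i; move: (bu i); set_cases.
Qed.

Lemma missing_cond_ii : F_b_missing ->
  join aF (full_simplex b) :&: X = join aF (bd_simplex b).
Proof.
move=> miss; apply/setP => u; rewrite inE mem_full_full mem_full_bd.
case uU: (core u \in U) => //=; case bu: (b \subset u) => /=.
  by apply/negbTE; apply: nonfaceS (miss _ uU) (F_b_sub bu).
by apply: core_face => //; rewrite bu.
Qed.

Lemma cond_ii_iii : join aF (full_simplex b) :&: X = join aF (bd_simplex b) ->
  [disjoint join aF [set b]%SET & X].
Proof.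
move=> eqJ; apply/finset.setDidPl/setP => u; rewrite inE mem_full_top.
have := congr1 (fun Y : {set {set 'I_n}} => u \in Y) eqJ.
rewrite inE mem_full_full mem_full_bd.
by case: (core u \in U); case: (b \subset u); case: (u \in X).
Qed.

Lemma cond_iii_missing : [disjoint join aF [set b]%SET & X] -> F_b_missing.
Proof.
move=> /disjoint_at dJ f fU; apply: contra (dJ ((f :\: a) :|: b)) => ->.
by rewrite mem_full_top core_F_b // fU finset.subsetUr.
Qed.

Definition flip :=
  (X :\: join aF (bd_simplex b)) :|:
  join (join (bd_simplex a) linkF) (full_simplex b).

Lemma mem_flip u : F_b_missing ->
  (u \in flip) = if core u \in U then ~~ (a \subset u) else u \in X.
Proof.
move=> miss; rewrite !inE mem_full_bd mem_bd_full.
case uU: (core u \in U) => /=; last by rewrite orbF.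
case bu: (b \subset u) => //=.
by rewrite (negbTE (nonfaceS (miss _ uU) (F_b_sub bu))).
Qed.

(** The right-hand side lists the sets that contain the support of a square-free
generator of the modified ideal. *)
Lemma flip_nonface s : F_b_missing ->
  s \notin flip <->
  (exists2 w, w \notin X /\ core w \notin U & w \subset s) \/
  (exists2 f, f \in U & f \subset s).
Proof.
move=> miss; rewrite mem_flip //; case: (boolP (core s \in U)) => sU; split.
- by rewrite negbK => sa; right; exists (core s) => //; exact: core_sub.
- rewrite negbK; case=> [[w [wX wU] ws]|[f /U_N[_ af _ _] fs]]; last first.
    exact: fintype.subset_trans af fs.
  (* Here w would be a non-face inside core w :|: b, so core w is in N_c and,
     being a subset of core s, it is in U. *)
  case/negP: wU; case/U_N: (sU) => sX _ _ _.
  apply: (U_comparable sU); rewrite ?sub_core ?core_disjoint ?(coreS ws) ?orbT //.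
    exact: cplX sX (coreS ws).
  by apply: nonfaceS wX _; apply/fintype.subsetP => i; set_cases.
- by move=> sX; left; exists s.
- case=> [[w [wX wU] ws]|[f fU fs]]; first exact: nonfaceS wX ws.
  case/U_N: (fU) => _ af _ fbX; apply: contra sU => sX.
  (* If s were a face, so would be core s, a superset of f; hence core s would
     be in N_c, and then in U. *)
  have fc := sub_core_id fU fs.
  apply: (U_comparable fU); rewrite ?sub_core ?core_disjoint ?fc //.
    by apply: (cplX sX); apply: core_sub; exact: fintype.subset_trans af fs.
  by apply: nonfaceS fbX _; exact: finset.setSU.
Qed.

Lemma flip_complex : F_b_missing -> simplicial_complex flip.
Proof.
move=> miss f g fX gf; apply: contraLR fX => /(flip_nonface _ miss) gX.
apply/(flip_nonface _ miss); case: gX => [[w wX wg]|[h hU hg]].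
  by left; exists w => //; exact: fintype.subset_trans wg gf.
by right; exists h => //; exact: fintype.subset_trans hg gf.
Qed.

(** * The modified ideal *)

Section Ideal.
Import Order.TTheory GRing.Theory Num.Theory.
Local Open Scope ring_scope.
Context (K : fieldType) (c : 'rV[int]_n).
Hypothesis cE : c = incidence a - incidence b.

Let M' := modified_ideal K X a b c U.

Lemma modified_ideal_X m : M' (mpolyX K m) <->
  (exists u, [/\ u \notin X, core u \notin U & u \subset mnm_support m]) \/
  (exists v, [/\ v \notin X, core v \in U &
     forall i, 0 <= (incidence v + c) 0 i <= (m i)%:Z]).
Proof.
rewrite /M' /modified_ideal ideal_sum_monomial monomial_ideal_X multipleU.
split=> [[[_ [u [uX uU ->]] /incidence_le um]|[_ [v [vX vU ->]] vm]]
        |[[u [uX uU um]]|[v [vX vU vm]]]].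
- by left; exists u.
- by right; exists v.
- by left; exists (incidence u); [exists u|apply/incidence_le].
- by right; exists (incidence v + c) => //; exists v.
Qed.

Lemma exponentE v i :
  (incidence v + c) 0 i = (i \in v)%:Z + (i \in a)%:Z - (i \in b)%:Z.
Proof. by rewrite cE !mxE addrA. Qed.

(** A non-face v with core in U contributes the square-free monomial of its core:
x^(v + c) is a multiple of it, and equal to it for v = (core v :\: a) :|: b, which
is a non-face by assumption. *)
Lemma modified_ideal_flip m : F_b_missing ->
  M' (mpolyX K m) <-> mnm_support m \notin flip.
Proof.
move=> miss; rewrite modified_ideal_X flip_nonface //.
split=> [[[u [uX uU um]]|[v [vX vU vm]]]|[[w [wX wU] wm]|[f fU fm]]].
- by left; exists u.
- right; exists (core v) => //; apply/fintype.subsetP => i /[!inE].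
  move: (vm i); rewrite exponentE; case: (i \in b) => //=.
  by case: (i \in v); case: (i \in a); case: (m i).
- by left; exists w.
- right; exists ((f :\: a) :|: b); rewrite core_F_b //; split=> // [|i].
    exact: miss.
  case/U_N: fU => _ /subset_at af /disjoint_at fb _.
  rewrite exponentE; move: (af i) (fb i) (disjoint_at dab i) (subset_at fm i).
  by rewrite !inE; case: (i \in f); case: (i \in a); case: (i \in b); case: (m i).
Qed.

(** With v = f :|: b the generator x^(v + c) is x^f x^a, and radicality brings x^f
into the ideal. It can only come from a generator x^(v + c) with v disjoint from
a, and such a v is a non-face contained in (f :\: a) :|: b. *)
Lemma squarefree_missing : squarefree_ideal M' -> F_b_missing.
Proof.
move=> sqM f fU; case/U_N: (fU) => fX af fb fbX.
have afb i : [&& (i \in a) ==> (i \in f), ~~ ((i \in f) && (i \in b)) &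
    ~~ ((i \in a) && (i \in b))].
  by rewrite (subset_at af) (disjoint_at fb) (disjoint_at dab).
(* The exponent of x^f x^a. *)
pose m := Multinom [tuple ((i \in f) + (i \in a))%N | i < n].
have mM : M' (mpolyX K m).
  apply/modified_ideal_X; right; exists (f :|: b); split=> // [|i].
    rewrite (_ : core _ = f) //; apply/setP => i.
    by move: (afb i); set_cases.
  rewrite exponentE mnmE inE; move: (afb i).
  by case: (i \in f); case: (i \in a); case: (i \in b).
have : M' (mpolyX K (mnm_of_set f)).
  apply: squarefree_radical sqM mM _; rewrite mnm_of_setK.
  apply/fintype.subsetP => i; rewrite inE mnmE; move: (afb i).
  by case: (i \in f); case: (i \in a).
rewrite modified_ideal_X mnm_of_setK => -[[u [uX _ uf]]|[v [vX vU vm]]].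
  by have := nonfaceS uX uf; rewrite fX.
apply: nonfaceS vX _; apply/fintype.subsetP => i; rewrite !inE.
move: (vm i) (afb i); rewrite exponentE mnmE.
by case: (i \in v); case: (i \in f); case: (i \in a); case: (i \in b).
Qed.

Lemma modified_ideal_SR : F_b_missing -> SR_ideal K flip = M'.
Proof.
move=> miss; rewrite /M' /modified_ideal ideal_sum_monomial.
apply: eq_monomial_ideal => m; rewrite multiple_SR; last exact: flip_complex.
by rewrite -modified_ideal_flip // /M' /modified_ideal ideal_sum_monomial
  monomial_ideal_X.
Qed.

End Ideal.

End Flip.

Theorem theorem19 (R : realType) (K : fieldType) (n : nat)
    (X : {set {set 'I_n}}) (a b : {set 'I_n}) (c : 'rV[int]_n)
    (Ns : {set {set {set 'I_n}}}) :
  simplicial_complex X ->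
  a != finset.set0 -> b != finset.set0 -> [disjoint a & b] ->
  pos_part c = incidence a -> neg_part c = incidence b ->
  Ns != finset.set0 ->
  (forall N : {set {set 'I_n}}, N \in Ns ->
     component_faces R (Nset X c) N /\ [disjoint N & Ntilde X c]) ->
  let M' := modified_ideal K X a b c (finset.cover Ns) in
  let F := [set f :\: a | f in finset.cover Ns]%SET in
  let cond_i := squarefree_ideal M' in
  let cond_ii :=
    join (join (full_simplex a) F) (full_simplex b) :&: X =
    join (join (full_simplex a) F) (bd_simplex b) in
  let cond_iii := [disjoint join (join (full_simplex a) F) [set b]%SET & X] in
  let cond_iv := X :&: join F [set b]%SET = finset.set0 in
  let X' := (X :\: join (join (full_simplex a) F) (bd_simplex b)) :|:
            join (join (bd_simplex a) F) (full_simplex b) in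
  [<-> cond_i; cond_ii; cond_iii; cond_iv] /\
  (cond_i ->
     (simplicial_complex X' /\ SR_ideal K X' = M') /\
     (forall Y : {set {set 'I_n}},
        simplicial_complex Y -> SR_ideal K Y = M' -> Y = X')).

Proof.
move=> cplX a0 b0 dab posc negc Ns0 NsP M' F cond_i cond_ii cond_iii cond_iv X'.
pose U := finset.cover Ns.
have NE f : f \in Nset X c ->
    [/\ f \in X, a \subset f, [disjoint f & b] & f :|: b \notin X].
  rewrite inE (supp_pos_part posc) (supp_neg_part negc) => /and4P[? ? ? ?].
  by split=> //; rewrite -finset.setI_eq0.
have NsU N : N \in Ns -> N \subset U by move=> NNs; exact: finset.bigcup_sup.
have U_Nset f : f \in U -> f \in Nset X c.
  by case/finset.bigcupP => N /NsP[[C _ NC] _] /NC[].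
have U_N f : f \in U ->
    [/\ f \in X, a \subset f, [disjoint f & b] & f :|: b \notin X].
  by move/U_Nset/NE.
have U_bd f (b' : {set 'I_n}) : f \in U -> b' \proper b -> f :|: b' \in X.
  move=> fU b'b; case/finset.bigcupP: (fU) => N /NsP[_ dN] fN.
  apply/negPn/negP => fb'X; have := disjoint_at dN f.
  rewrite fN /= inE (U_Nset _ fU) /= => /existsP[]; exists b'.
  by rewrite (supp_neg_part negc) b'b.
have U_comp f g : f \in U -> g \in X -> a \subset g -> [disjoint g & b] ->
    g :|: b \notin X -> (f \subset g) || (g \subset f) -> g \in U.
  case/finset.bigcupP => N NNs fN gX ag gb gbX fg.
  have [compN _] := NsP N NNs.
  apply: (fintype.subsetP (NsU _ NNs)).
  apply: (component_faces_comparable compN fN _ _ fg).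
    have [_ af _ _] := U_N f (fintype.subsetP (NsU _ NNs) _ fN).
    by apply: contraNneq a0 => f0; move: af; rewrite f0 finset.subset0.
  rewrite inE gX (supp_pos_part posc) (supp_neg_part negc) ag gbX andbT /=.
  by rewrite finset.setI_eq0.
have cE := incidence_diff posc negc.
have i_miss : cond_i -> F_b_missing X a b U.
  exact: (squarefree_missing cplX dab U_N cE).
have SR : F_b_missing X a b U -> SR_ideal K X' = M'.
  exact: (modified_ideal_SR cplX dab U_N U_comp K cE).
split.
  tfae.
  - by move/i_miss; exact: missing_cond_ii.
  - exact: cond_ii_iii.
  - by move/cond_iii_missing => miss; apply/F_b_missingP; exact: miss.
  - move/F_b_missingP => miss; rewrite /cond_i -SR //; exact: SR_ideal_squarefree.
move/i_miss => miss; have cplX' : simplicial_complex X' by exact: flip_complex.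
split; first by split=> //; exact: SR.
by move=> Y cY YM; apply: (@SR_ideal_inj K) => //; rewrite YM SR.
Qed.
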